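(* There exist absolute constants $c,C>0$ such that for every distribution $\mathcal D$ on $[0,1]\times\{0,1\}$, $$c\,\mathsf{DistCal}(\mathcal D)^2\le\mathsf{SCDL}(\mathcal D)\le C\sqrt{\mathsf{DistCal}(\mathcal D)}.$$
   Context: For $x\in\mathbb R$ write $x_+=\max\{x,0\}$. For a distribution $\mathcal D$ of $(p,y)\in[0,1]\times\{0,1\}$, a positive integer $m$ and $i\in\{0,\ldots,m\}$, let $w_i(p)=(1-|mp-i|)_+$, $\pi_i=\mathbb E_{\mathcal D}[w_i(p)]$ and $q_i=\mathbb E_{\mathcal D}[w_i(p)y]/\pi_i$ (terms with $\pi_i=0$ are $0$). Define $$\mathsf{SCDL}_m(\mathcal D)=\max_{i=0,\ldots,m}\Big(\sum_{j=0}^{i}\pi_j\big(q_j-\tfrac{i+1}{m}\big)_+ +\sum_{j=i+1}^{m}\pi_j\big(\tfrac im-q_j\big)_+\Big),\quad \mathsf{SCDL}(\mathcal D)=\inf_{m\in\{2^1,2^2,\ldots\}}\max\{\mathsf{SCDL}_m(\mathcal D),1/m\}.$$ A distribution of $(p,y)$ is calibrated if $\mathbb E[y\mid p]=p$. The lower distance to calibration is $\mathsf{DistCal}(\mathcal D)=\inf_{\mathcal J}\mathbb E_{(p,p',y)\sim\mathcal J}|p-p'|$, the infimum over all joint distributions $\mathcal J$ of $(p,p',y)\in[0,1]\times[0,1]\times\{0,1\}$ whose $(p,y)$-marginal is $\mathcal D$ and whose $(p',y)$-marginal is calibrated. *)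

(* Defs.v *)
From HB Require Import structures.
From mathcomp Require Import all_boot all_order all_algebra.
From mathcomp Require Import all_classical all_reals all_analysis.
From mathcomp Require Import Rstruct Rstruct_topology.
Set Implicit Arguments. Unset Strict Implicit. Unset Printing Implicit Defensive.
Import Order.TTheory GRing.Theory Num.Theory.
Local Open Scope classical_set_scope.
Local Open Scope ring_scope.

Section SmoothCalibration.
Context {R : realType}.

Notation distr := (probability (R * bool)%type R).

Definition supported01 (D : distr) : Prop :=
  D [set z | 0 <= z.1 <= 1] = 1%E.

Definition yR (b : bool) : R := (b : nat)%:R.

Definition expect (D : distr) (f : R * bool -> R) : R :=
  fine (\int[D]_z (f z)%:E)%E.

Definition wgt (m i : nat) (p : R) : R :=
  Num.max (1 - `|m%:R * p - i%:R|) 0.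

Definition piw (D : distr) (m i : nat) : R := expect D (fun z => wgt m i z.1).

Definition qw (D : distr) (m i : nat) : R :=
  if piw D m i == 0 then 0
  else expect D (fun z => wgt m i z.1 * yR z.2) / piw D m i.

Definition pos (x : R) : R := Num.max x 0.

Definition SCDL_m (D : distr) (m : nat) : R :=
  \big[Num.max/0]_(0 <= i < m.+1)
    (\sum_(0 <= j < i.+1) piw D m j * pos (qw D m j - i.+1%:R / m%:R)
   + \sum_(i.+1 <= j < m.+1) piw D m j * pos (i%:R / m%:R - qw D m j)).

Definition SCDL (D : distr) : R :=
  inf [set x | exists k : nat, (1 <= k)%N /\
                 x = Num.max (SCDL_m D (2 ^ k)) (2 ^ k)%:R^-1].

(* calibration: E[y | p] = p, i.e. for every Borel set B,
   E[y 1_B(p)] = E[p 1_B(p)]; plus p in [0,1] a.s. *)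
Definition calibrated (Q : distr) : Prop :=
  supported01 Q /\
  forall B : set R, measurable B ->
    (\int[Q]_(z in B `*` setT) (yR z.2)%:E = \int[Q]_(z in B `*` setT) (z.1)%:E)%E.

Definition coupling (D : distr) (J : probability ((R * R) * bool)%type R) : Prop :=
  (forall A : set (R * bool), measurable A ->
     J ((fun z : (R * R) * bool => (z.1.1, z.2)) @^-1` A) = D A) /\
  exists Q : distr,
    (forall A : set (R * bool), measurable A ->
       J ((fun z : (R * R) * bool => (z.1.2, z.2)) @^-1` A) = Q A) /\
    calibrated Q.

Definition DistCal (D : distr) : R :=
  fine (ereal_inf [set (\int[J]_z (`|z.1.1 - z.1.2|)%:E)%E | J in coupling D]).

End SmoothCalibration.

(* Main.v *)
(* Upper bound.  Take a coupling J of (p, p', y) with E|p - p'| = e.  The hat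
   weight w_j vanishes above (j+1)/m, so calibration of (p', y) gives
   E[w_j(p')(y - t)] <= 0 for t >= (j+1)/m, and symmetrically below.  Replacing
   p' by p costs a multiple of E|w_j(p) - w_j(p')|, and the hats overlap so
   little that these sum over j to O(m e).  Hence SCDL_m <= O(m e), and
   m ~ 1/sqrt e balances this against 1/m.

   Lower bound.  Round p to the cell j with probability w_j(p) and let p' = q_j;
   (p', y) is calibrated and E|p - p'| <= 1/m + A with
   A = sum_j pi_j |q_j - j/m|.  By Jensen's inequality
   A^2 <= sum_j pi_j (q_j - j/m)^2, and (q_j - j/m)^2 / 2 is, up to O(1/m), a
   Riemann sum with step 1/m of the V-shaped losses whose pi-average at each
   threshold i is at most SCDL_m.  Hence A^2 <= 4 SCDL_m + 2/m. *)
Require Import Defs.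
From HB Require Import structures.
From mathcomp Require Import all_boot all_order all_algebra.
From mathcomp Require Import all_classical all_reals all_analysis.
From mathcomp Require Import Rstruct Rstruct_topology.
From mathcomp Require Import measurable_realfun lebesgue_Rintegral ring lra.
Import Order.TTheory GRing.Theory Num.Theory.
Local Open Scope ring_scope.
Set Implicit Arguments. Unset Strict Implicit. Unset Printing Implicit Defensive.
Local Open Scope classical_set_scope.

(** * Integration against a measure given by a density *)

Section Density.
Local Open Scope ereal_scope.
Context d (T : measurableType d) (R : realType).
Context (mu : {measure set T -> \bar R}) (g : T -> R).
Context (mg : measurable_fun setT g) (g0 : forall x, (0 <= g x)%R).

(* The two proofs are arguments so that the measure instance below can be
   inferred from the term alone. *)
Definition density_measure of measurable_fun setT g & (forall x, (0 <= g x)%R) :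
  set T -> \bar R := fun A => \int[mu]_(x in A) (g x)%:E.

Let nu := density_measure mg g0.

Let mgE (A : set T) : measurable_fun A (fun x => (g x)%:E).
Proof. exact/measurable_EFinP/measurable_funTS. Qed.

Let nu0 : nu set0 = 0.
Proof. by rewrite /nu /density_measure integral_set0. Qed.

Let nu_ge0 A : 0 <= nu A.
Proof. by apply: integral_ge0 => x _; rewrite lee_fin. Qed.

Let nu_sigma_additive : semi_sigma_additive nu.
Proof.
move=> F mF tF mUF; rewrite /nu /density_measure.
rewrite ge0_integral_bigcup//; last by move=> x _; rewrite lee_fin.
apply: is_cvg_ereal_nneg_natsum_cond => n _ _.
by apply: integral_ge0 => x _; rewrite lee_fin.
Qed.

HB.instance Definition _ := isMeasure.Build _ _ _ (density_measure mg g0)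
  nu0 nu_ge0 nu_sigma_additive.

Let numeas : {measure set T -> \bar R} := density_measure mg g0.

Import HBNNSimple.

(** By monotone convergence both sides are limits of integrals of the simple functions [h n]; on
    each level set of [h n] the claim is the definition of the density measure. *)
Lemma ge0_integral_density (f : T -> \bar R) :
  measurable_fun setT f -> (forall x, 0 <= f x) ->
  \int[density_measure mg g0]_x f x = \int[mu]_x (f x * (g x)%:E).
Proof.
move=> mf f0; pose h := nnsfun_approx measurableT mf.
have mh n : measurable_fun setT (EFin \o h n).
  exact/measurable_EFinP/measurable_funP.
have fE x : f x = lim ((EFin \o h n) x @[n --> \oo]).
  by apply/esym/cvg_lim => //; exact: cvg_nnsfun_approx.
transitivity (lim (\int[numeas]_x (EFin \o h n) x @[n --> \oo])).
  rewrite -monotone_convergence//.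
  - by apply: eq_integral => x _; rewrite fE.
  - by move=> n x _ /=; rewrite lee_fin.
  - by move=> x _ a b ab; rewrite lee_fin; exact/lefP/nd_nnsfun_approx.
transitivity (lim (\int[mu]_x ((EFin \o h n) x * (g x)%:E) @[n --> \oo])); last first.
  rewrite -monotone_convergence//.
  - apply: eq_integral => x _; apply/cvg_lim => //.
    by apply: cvgeZr => //; exact: cvg_nnsfun_approx.
  - by move=> n; exact: emeasurable_funM.
  - by move=> n x _; rewrite mule_ge0 ?lee_fin.
  - move=> x _ a b ab; rewrite lee_wpmul2r ?lee_fin//.
    exact/lefP/nd_nnsfun_approx.
suff suf n : \int[numeas]_x (EFin \o h n) x = \int[mu]_x ((EFin \o h n) x * (g x)%:E).
  by under eq_fun do rewrite suf.
under [LHS]eq_integral do rewrite /= fimfunE -fsumEFin//.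
have indich r : measurable_fun setT (fun x => (r * \1_(h n @^-1` [set r]) x)%:E).
  by apply/measurable_EFinP; exact: measurable_funM.
rewrite ge0_integral_fsum//; last by move=> m y _; exact: nnfun_muleindic_ge0.
under [RHS]eq_integral => x xE.
  rewrite /= fimfunE -fsumEFin// ge0_mule_fsuml => [|y]; last exact: nnfun_muleindic_ge0.
  over.
rewrite ge0_integral_fsum//; last 2 first.
  - by move=> y; exact: emeasurable_funM.
  - by move=> m y _; rewrite mule_ge0 ?lee_fin// -lee_fin nnfun_muleindic_ge0.
apply: eq_fsbigr => r rhn.
under eq_integral do rewrite EFinM.
rewrite integralZl_indic_nnsfun => //.
under [RHS]eq_integral do rewrite EFinM -muleA.
rewrite ge0_integralZl//.
- under [in RHS]eq_integral do rewrite muleC.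
  rewrite [in RHS](eq_integral ((EFin \o g) \_ (h n @^-1` [set r]))); last first.
    by move=> x xE; rewrite epatch_indic.
  by rewrite -integral_mkcond integral_indic// setIT.
- by apply: emeasurable_funM => //; exact/measurable_EFinP.
- by move=> t Et; rewrite mule_ge0 ?lee_fin.
- by move: rhn; rewrite inE => -[t _ <-]; rewrite lee_fin.
Qed.

End Density.

(** * Hat weights and Riemann sums of V-shaped losses *)

Section Weights.
Context {R : realType}.
Implicit Types (m i n : nat) (p x y q h t : R).

Lemma wgt_ge0 m i p : 0 <= wgt m i p.
Proof. by rewrite le_max lexx orbT. Qed.

Lemma wgt_le1 m i p : wgt m i p <= 1.
Proof. by rewrite ge_max ler01 gerBl normr_ge0. Qed.

Lemma wgt_eq0 m i p : 1 <= `|m%:R * p - i%:R| -> wgt m i p = 0.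
Proof. by move=> ?; apply/max_idPr; rewrite subr_le0. Qed.

(** Adding the hat centred at [s] to a ramp that falls from 1 to 0 on [[s - 1, s]] moves the ramp
    one unit to the right. *)
Lemma clamp_step s x : Num.max 0 (Num.min 1 (s - x)) + Num.max (1 - `|x - s|) 0 =
  Num.max 0 (Num.min 1 (s + 1 - x)).
Proof.
have c1 y : 1 <= y -> Num.max 0 (Num.min 1 y) = 1.
  by move=> y1; rewrite (min_idPl y1) (max_idPr _).
have c01 y : 0 <= y <= 1 -> Num.max 0 (Num.min 1 y) = y.
  by move=> /andP[y0 y1]; rewrite (min_idPr y1) (max_idPr y0).
have c0 y : y <= 0 -> Num.max 0 (Num.min 1 y) = 0.
  by move=> y0; apply/max_idPl; rewrite ge_min y0 orbT.
have [xs|xs] := leP x (s - 1).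
  rewrite !c1; [|lra|lra]; rewrite (max_idPr _) ?addr0//.
  by rewrite ler0_norm; lra.
have [xs'|xs'] := leP x s.
  rewrite c01; last by lra.
  rewrite c1; last by lra.
  by rewrite ler0_norm ?(max_idPl _); lra.
rewrite c0 ?add0r; last by lra.
rewrite gtr0_norm; last by lra.
have [xs''|xs''] := leP x (s + 1).
  by rewrite c01 ?(max_idPl _); lra.
by rewrite c0 ?(max_idPr _); lra.
Qed.

(** The hats telescope into a single ramp. With [0 <= p], the rising flank of hat 0 is never met, so
    hat 0 alone is already the first ramp. *)
Lemma sum_wgt_clamp m n p : 0 <= p ->
  \sum_(0 <= j < n.+1) wgt m j p = Num.max 0 (Num.min 1 (n.+1%:R - m%:R * p)).
Proof.
move=> p0; have : 0 <= m%:R * p by rewrite mulr_ge0.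
rewrite /wgt; move: (m%:R * p) => x x0.
elim: n => [|n IH].
  rewrite big_nat1 subr0 ger0_norm// maxC; congr (Num.max _ _).
  by apply/esym/min_idPr; lra.
by rewrite big_nat_recr//= IH clamp_step natr1.
Qed.

Lemma sum_wgt m p : 0 <= p <= 1 -> \sum_(0 <= j < m.+1) wgt m j p = 1.
Proof.
move=> /andP[p0 p1]; rewrite sum_wgt_clamp//.
have mp : m%:R * p <= m%:R by rewrite ler_piMr.
by rewrite (min_idPl _) ?max_r// -natr1; lra.
Qed.

(** A hat is 1-Lipschitz in [m p], and the difference vanishes unless [x] or [y] is in its open
    support. Keeping the two indicators makes the later sum over [i] independent of the number of
    cells. *)
Lemma wgt_dist m i x y :
  `|wgt m i x - wgt m i y| <= m%:R * `|x - y| *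
    ((`|m%:R * x - i%:R| < 1)%R%:R + (`|m%:R * y - i%:R| < 1)%R%:R).
Proof.
have -> : m%:R * `|x - y| = `|m%:R * x - m%:R * y|.
  by rewrite -mulrBr normrM normr_nat.
rewrite /wgt; move: (m%:R * x) (m%:R * y) (i%:R) => a b k {x y m i}.
have := ler_dist_dist (a - k) (b - k).
have -> : a - k - (b - k) = a - b by ring.
have := normr_ge0 (a - b).
move: `|a - b| `|a - k| `|b - k| => D u v D0; rewrite ler_norml => /andP[uv vu].
rewrite /Num.max; case: (ltP (1 - u) 0) => ?; case: (ltP (1 - v) 0) => ?;
  case: (ltP u 1) => ?; case: (ltP v 1) => ? /=; rewrite ler_norml; lra.
Qed.

Lemma count_near n x : \sum_(0 <= j < n) (`|x - j%:R| < 1)%R%:R <= 2 :> R.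
Proof.
(* The bound 2 is not inductive alone: a new index [n] that counts forces [n - 1 < x], and then at
   most one earlier index counts, which in turn rests on none counting beyond the range. *)
suff [_ _] : [/\ n%:R <= x -> \sum_(0 <= j < n) (`|x - j%:R| < 1)%R%:R = 0 :> R,
    n%:R - 1 <= x -> \sum_(0 <= j < n) (`|x - j%:R| < 1)%R%:R <= 1 :> R &
    \sum_(0 <= j < n) (`|x - j%:R| < 1)%R%:R <= 2 :> R] by [].
elim: n => [|n [IH0 IH1 IH2]]; first by rewrite big_geq//; split.
rewrite big_nat_recr//= -natr1; split=> [nx|nx|].
- rewrite IH0; last by lra.
  by rewrite add0r; case: ltP => //; rewrite ltr_norml; lra.
- by rewrite IH0 ?add0r; [case: ltP => //; lra|lra].
- have [nx|nx] := leP (n%:R - 1) x.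
    by have := IH1 nx; case: ltP => _ /=; lra.
  case: ltP => /=; last by move=> _; lra.
  by rewrite ltr_norml; lra.
Qed.

(** The constant is 4 because at most two hats are active at [x] and at most two at [y]. *)
Lemma sum_wgt_dist m n x y :
  \sum_(0 <= j < n) `|wgt m j x - wgt m j y| <= 4 * m%:R * `|x - y|.
Proof.
apply: (@le_trans _ _ (\sum_(0 <= j < n) m%:R * `|x - y| *
    ((`|m%:R * x - j%:R| < 1)%R%:R + (`|m%:R * y - j%:R| < 1)%R%:R))).
  by apply: ler_sum => j _; exact: wgt_dist.
rewrite -mulr_sumr big_split/=.
have -> : 4 * m%:R * `|x - y| = m%:R * `|x - y| * (2 + 2) by ring.
by apply: ler_wpM2l; [rewrite mulr_ge0|apply: lerD; exact: count_near].
Qed.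

Lemma wgt_near m i p : (0 < m)%N ->
  wgt m i p * `|p - i%:R / m%:R| <= m%:R^-1 * wgt m i p.
Proof.
move=> m0; have m0' : 0 < m%:R :> R by rewrite ltr0n.
have [h|h] := leP 1 `|m%:R * p - i%:R|; first by rewrite wgt_eq0// mul0r mulr0.
rewrite mulrC; apply: ler_wpM2r; first exact: wgt_ge0.
rewrite -[leRHS]mul1r ler_pdivlMr// -[X in _ * X](normr_nat R m) -normrM.
rewrite mulrBl divfK ?gt_eqF// (mulrC p); exact: ltW.
Qed.

Lemma pos_ge0 x : 0 <= pos x.
Proof. by rewrite le_max lexx orbT. Qed.

(** The derivative [2 * pos] of [pos ^+ 2] is nondecreasing, so over a step of length [h] it is at
    most its value at the right end. *)
Lemma pos_sqr_step x h : 0 <= h -> pos x ^+ 2 - pos (x - h) ^+ 2 <= 2 * h * pos x.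
Proof. by move=> h0; rewrite /pos /Num.max; case: (ltP x 0) => ?; case: (ltP (x - h) 0) => ?; nra. Qed.

(* Riemann sums, with step [h], of the integral of [t |-> pos (q - t)] *)
Lemma sum_pos_ge_down h q j n : 0 <= h -> q <= n.+1%:R * h -> (j <= n)%N ->
  pos (q - j%:R * h) ^+ 2 <= 2 * h * \sum_(j <= i < n.+1) pos (q - i%:R * h).
Proof.
move=> h0 qn jn; rewrite mulr_sumr.
have -> : pos (q - j%:R * h) ^+ 2 =
    \sum_(j <= i < n.+1) (pos (q - i%:R * h) ^+ 2 - pos (q - i.+1%:R * h) ^+ 2).
  rewrite (eq_bigr (fun i => - pos (q - i.+1%:R * h) ^+ 2 - - pos (q - i%:R * h) ^+ 2));
    last by move=> i _; ring.
  rewrite (@telescope_sumr _ j n.+1 (fun i => - pos (q - i%:R * h) ^+ 2)) ?leqW//.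
  rewrite [pos (q - n.+1%:R * h)](max_idPr _); last by lra.
  by rewrite expr0n/= oppr0 opprK add0r.
apply: ler_sum => i _.
have -> : q - i.+1%:R * h = q - i%:R * h - h by rewrite -natr1; ring.
exact: pos_sqr_step.
Qed.

(** The mirror image for thresholds below [j]. The squares telescope from [pos (- h - q)], which is
    0; the loss of one step [h] on the left comes from comparing each increment with its upper
    end. *)
Lemma sum_pos_ge_up h q j : 0 <= h -> 0 <= q ->
  pos (j%:R * h - h - q) ^+ 2 <= 2 * h * \sum_(0 <= i < j) pos (i%:R * h - q).
Proof.
move=> h0 q0; rewrite mulr_sumr.
have -> : pos (j%:R * h - h - q) ^+ 2 =
    \sum_(0 <= i < j) (pos (i.+1%:R * h - h - q) ^+ 2 - pos (i%:R * h - h - q) ^+ 2).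
  rewrite (@telescope_sumr _ 0 j (fun i => pos (i%:R * h - h - q) ^+ 2))//.
  rewrite [pos (0%:R * h - h - q)](max_idPr _); last by lra.
  by rewrite expr0n/= subr0.
apply: ler_sum => i _.
have -> : i.+1%:R * h - h - q = i%:R * h - q by rewrite -natr1; ring.
have -> : i%:R * h - h - q = i%:R * h - q - h by ring.
exact: pos_sqr_step.
Qed.

(** The summand is the loss that a cell [j] with mean [q] suffers in [SCDL_m] at threshold [i]. The
    thresholds from [j] on charge [q] for being too large, those before [j] for being too small, and
    each half is a Riemann sum of a quadratic. *)
Lemma sum_decision_ge m j q : (0 < m)%N -> (j <= m)%N -> 0 <= q <= 1 ->
  (q - j%:R / m%:R) ^+ 2 - 2 / m%:R <= 2 / m%:R *
    \sum_(0 <= i < m.+1) (if (j <= i)%N then pos (q - i.+1%:R / m%:R)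
                          else pos (i%:R / m%:R - q)).
Proof.
move=> m0 jm /andP[q0 q1]; have m0' : 0 < m%:R :> R by rewrite ltr0n.
set h := m%:R^-1; have h0 : 0 <= h by rewrite invr_ge0 ltW.
have mh : m%:R * h = 1 by rewrite mulfV ?gt_eqF.
rewrite (big_cat_nat _ (n := j)) ?leqW//= mulrDr.
have -> : \sum_(0 <= i < j) (if (j <= i)%N then pos (q - i.+1%:R * h)
    else pos (i%:R * h - q)) = \sum_(0 <= i < j) pos (i%:R * h - q).
  by apply: eq_big_nat => i /andP[_ ij]; rewrite leqNgt ij.
have -> : \sum_(j <= i < m.+1) (if (j <= i)%N then pos (q - i.+1%:R * h)
    else pos (i%:R * h - q)) = \sum_(j <= i < m.+1) pos (q - h - i%:R * h).
  by apply: eq_big_nat => i /andP[ij _]; rewrite ij -natr1; congr pos; ring.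
have up := @sum_pos_ge_up h q j h0 q0.
have dn : pos (q - h - j%:R * h) ^+ 2 <=
    2 * h * \sum_(j <= i < m.+1) pos (q - h - i%:R * h).
  apply: sum_pos_ge_down => //; rewrite -natr1 mulrDl mh; lra.
have jh0 : 0 <= j%:R * h by rewrite mulr_ge0.
have jh1 : j%:R * h <= 1 by rewrite -[leRHS]mh ler_wpM2r// ler_nat.
move: up dn; set U := 2 * h * \sum_(0 <= i < j) _; set V := 2 * h * _.
move: (j%:R * h) jh0 jh1 => t t0 t1.
(* The right side is the square of the positive part of [|q - t| - h]; as [|q - t| <= 1], dropping
   the shift costs at most [2 * h]. *)
suff: (q - t) ^+ 2 - 2 * h <= pos (t - h - q) ^+ 2 + pos (q - h - t) ^+ 2 by lra.
rewrite /pos /Num.max; case: (ltP (t - h - q) 0) => ?; case: (ltP (q - h - t) 0) => ?; nra.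
Qed.

Lemma measurable_wgt m i : measurable_fun setT (wgt m i : R -> R).
Proof.
apply: measurable_maxr => //; apply: measurable_funB => //.
apply: measurableT_comp => //; exact: measurable_funB.
Qed.

Lemma measurable_yR : measurable_fun setT (yR : bool -> R).
Proof. by []. Qed.

End Weights.

(** * Integrals of bounded functions and change of variables *)

Section Expectation.
Context d (T : measurableType d) (R : realType) (P : probability T R).
Implicit Types f : T -> R.

Lemma bounded_integrable f (M : R) : measurable_fun setT f ->
  (forall x, `|f x| <= M) -> P.-integrable setT (EFin \o f).
Proof.
move=> mf fM; apply: measurable_bounded_integrable => //.
  exact: le_lt_trans (probability_le1 _ _) (ltry _).
exists M; split; first exact: num_real.
by move=> N MN x _; apply: le_trans (fM x) (ltW MN).
Qed.

Lemma integrable_subr f g : P.-integrable setT (EFin \o f) ->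
  P.-integrable setT (EFin \o g) ->
  P.-integrable setT (EFin \o (fun x => f x - g x)).
Proof. by move=> If Ig; have := integrableB measurableT If Ig. Qed.

Lemma Rintegral_sum n (f : nat -> T -> R) :
  (forall i, P.-integrable setT (EFin \o f i)) ->
  \int[P]_x (\sum_(0 <= i < n) f i x) = \sum_(0 <= i < n) \int[P]_x f i x.
Proof.
move=> fi; elim: n => [|n IH].
  by rewrite big_geq// /Rintegral integral0_eq// => x _; rewrite big_geq.
rewrite big_nat_recr//= -IH -RintegralD//; last first.
  have := @integrable_sum _ _ _ P setT measurableT _ (index_iota 0 n) xpredT
    (fun i => EFin \o f i) (fun i _ => fi i).
  by apply: eq_integrable => // x _; rewrite /= sumEFin.
by apply: eq_Rintegral => x _; rewrite big_nat_recr.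
Qed.

End Expectation.

Lemma Rintegral_transfer d1 d2 (X : measurableType d1) (Y : measurableType d2)
    (R : realType) (J : probability X R) (D : probability Y R) (phi : X -> Y)
    (f : Y -> R) : measurable_fun setT phi ->
  (forall A, measurable A -> J (phi @^-1` A) = D A) ->
  measurable_fun setT f -> (forall y, 0 <= f y) ->
  \int[D]_y f y = \int[J]_x f (phi x).
Proof.
move=> mphi JD mf f0; rewrite /Rintegral; congr fine.
rewrite (eq_measure_integral (pushforward J phi)); last first.
  by move=> A mA _; exact: (esym (JD A mA)).
rewrite ge0_integral_pushforward//; first exact/measurable_EFinP.
by move=> y _; rewrite lee_fin.
Qed.

(** * Calibration tested against functions of the prediction *)

Section Calibrated.
Context (R : realType).
Implicit Types (Q D : probability (R * bool)%type R).

Lemma yR_ge0 b : 0 <= yR b :> R. Proof. exact: ler0n. Qed.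
Lemma yR_le1 b : yR b <= 1 :> R. Proof. by rewrite /yR; case: b. Qed.

Lemma supported01_ae Q : supported01 Q -> {ae Q, forall z, 0 <= z.1 <= 1}.
Proof.
move=> Q1; have mS : measurable [set z : R * bool | 0 <= z.1 <= 1].
  rewrite (_ : [set _ | _] = `[0, 1]%classic `*` setT).
    exact: measurableX.
  by apply/seteqP; split => z /=; rewrite in_itv/=; tauto.
exists (~` [set z : R * bool | 0 <= z.1 <= 1]); split => //.
- exact: measurableC.
- have := probability_setC Q mS; rewrite /= => ->.
  by move: Q1; rewrite /supported01 => ->; rewrite subee.
Qed.

(** Calibration on Borel sets says that [y dQ] and [p dQ] have the same image under [p]; [f] is then
    integrated against that image. A density must be nonnegative everywhere while [p] is so only
    almost surely, hence [pos z.1]. *)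
Lemma calibrated_integral Q (f : R -> R) : calibrated Q ->
  measurable_fun setT f -> (forall x, 0 <= f x) ->
  (\int[Q]_z (f z.1 * yR z.2)%:E = \int[Q]_z (f z.1 * pos z.1)%:E)%E.
Proof.
move=> [Q01 Qcal] mf f0.
have my : measurable_fun setT (fun z : R * bool => yR z.2 : R).
  exact: (measurableT_comp (@measurable_yR R) measurable_snd).
have mp : measurable_fun setT (fun z : R * bool => pos z.1 : R).
  by apply: measurable_maxr => //; exact: measurable_fst.
have y0 (z : R * bool) : 0 <= yR z.2 :> R by exact: yR_ge0.
have p0 (z : R * bool) : 0 <= pos z.1 by exact: pos_ge0.
have dE (g : R * bool -> R) (mg : measurable_fun setT g) (g0 : forall z, 0 <= g z) :
    (\int[Q]_z (f z.1 * g z)%:E =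
     \int[pushforward (density_measure Q mg g0) fst]_x (f x)%:E)%E.
  rewrite (ge0_integral_pushforward measurable_fst)//=; last 2 first.
  - exact/measurable_EFinP.
  - by move=> x _; rewrite lee_fin.
  rewrite preimage_setT ge0_integral_density//=; last first.
    by move=> z; rewrite lee_fin.
  by apply/measurable_EFinP; exact: (measurableT_comp mf measurable_fst).
rewrite (dE _ my y0) (dE _ mp p0); apply: eq_measure_integral => A mA _.
rewrite /= /pushforward /density_measure.
have -> : fst @^-1` A = A `*` [set: bool] by apply/seteqP; split => z //=; tauto.
rewrite Qcal//; apply: ae_eq_integral => //.
- exact: measurableX.
- by apply/measurable_EFinP/measurable_funTS; exact: measurable_fst.
- exact/measurable_EFinP/measurable_funTS.
- apply: filterS (supported01_ae Q01) => z /andP[z0 _] _.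
  by rewrite /pos max_l.
Qed.

End Calibrated.

(** * Measurability and integrability of the weights *)

Section WeightIntegrals.
Context d (T : measurableType d) (R : realType) (P : probability T R).
Context (p : T -> R) (y : T -> bool).
Context (mp : measurable_fun setT p) (my : measurable_fun setT y).

Lemma measurable_wgt_comp m j : measurable_fun setT (fun x => wgt m j (p x)).
Proof. exact: measurableT_comp (measurable_wgt _ _) mp. Qed.

Lemma measurable_wgt_yR m j :
  measurable_fun setT (fun x => wgt m j (p x) * yR (y x)).
Proof.
apply: measurable_funM; first exact: measurable_wgt_comp.
exact: measurableT_comp measurable_yR my.
Qed.

Lemma wgt_yR_ge0 m j (x : R) b : 0 <= wgt m j x * yR b.
Proof. by rewrite mulr_ge0 ?wgt_ge0 ?yR_ge0. Qed.

Lemma wgt_yR_le m j (x : R) b : wgt m j x * yR b <= wgt m j x.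
Proof. by rewrite ler_piMr ?wgt_ge0 ?yR_le1. Qed.

Lemma integrable_wgt m j : P.-integrable setT (EFin \o (fun x => wgt m j (p x))).
Proof.
apply: (@bounded_integrable _ _ _ _ _ 1); first exact: measurable_wgt_comp.
by move=> x; rewrite ger0_norm ?wgt_ge0 ?wgt_le1.
Qed.

Lemma integrable_wgt_yR m j :
  P.-integrable setT (EFin \o (fun x => wgt m j (p x) * yR (y x))).
Proof.
apply: (@bounded_integrable _ _ _ _ _ 1); first exact: measurable_wgt_yR.
move=> x; rewrite ger0_norm ?wgt_yR_ge0//.
exact: le_trans (wgt_yR_le _ _ _ _) (wgt_le1 _ _ _).
Qed.

End WeightIntegrals.

(** * Cell masses and cell means *)

Section Cells.
Context (R : realType) (D : probability (R * bool)%type R).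

Lemma piw_ge0 m j : 0 <= piw D m j.
Proof. by apply: Rintegral_ge0 => z _; exact: wgt_ge0. Qed.

Lemma expect_wgt_yR_ge0 m j : 0 <= expect D (fun z => wgt m j z.1 * yR z.2).
Proof. by apply: Rintegral_ge0 => z _; exact: wgt_yR_ge0. Qed.

Lemma expect_wgt_yR_le m j :
  expect D (fun z => wgt m j z.1 * yR z.2) <= piw D m j.
Proof.
apply: le_Rintegral => //.
- exact: integrable_wgt_yR measurable_fst measurable_snd _ _.
- exact: integrable_wgt measurable_fst _ _.
- by move=> z _; exact: wgt_yR_le.
Qed.

(** The default [qw = 0] on an empty cell does no harm: the numerator lies between 0 and the mass,
    so it vanishes too. *)
Lemma piw_qw m j : piw D m j * qw D m j = expect D (fun z => wgt m j z.1 * yR z.2).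
Proof.
rewrite /qw; case: eqP => [pi0|/eqP pi0]; last by rewrite mulrC divfK.
rewrite mulr0; apply/esym/eqP; rewrite eq_le expect_wgt_yR_ge0 andbT.
by rewrite -pi0 expect_wgt_yR_le.
Qed.

Lemma qw01 m j : 0 <= qw D m j <= 1.
Proof.
rewrite /qw; case: eqP => [_|/eqP pi0]; first by rewrite lexx ler01.
rewrite divr_ge0 ?expect_wgt_yR_ge0 ?piw_ge0//=.
by rewrite ler_pdivrMr ?mul1r ?expect_wgt_yR_le// lt_neqAle eq_sym pi0 piw_ge0.
Qed.

End Cells.

(** * Upper bound: moving a calibrated prediction to the given one *)

Section Transport.
Context (R : realType) (D : probability (R * bool)%type R).
Context (J : probability ((R * R) * bool)%type R) (DJ : coupling D J).

Let mp : measurable_fun setT (fun z : (R * R) * bool => z.1.1).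
Proof. exact: measurableT_comp measurable_fst measurable_fst. Qed.

Let mp' : measurable_fun setT (fun z : (R * R) * bool => z.1.2).
Proof. exact: measurableT_comp measurable_snd measurable_fst. Qed.

Let my : measurable_fun setT (fun z : (R * R) * bool => z.2).
Proof. exact: measurable_snd. Qed.

(** Since [y] is 0 or 1, this one quantity bounds the change of both the mass and the [y]-weighted
    mass of cell [j] when [p] becomes [p']. *)
Definition wgt_shift m j : R := \int[J]_z `|wgt m j z.1.1 - wgt m j z.1.2|.

Lemma wgt_shift_ge0 m j : 0 <= wgt_shift m j.
Proof. exact: Rintegral_ge0. Qed.

Let integrable_dist m j :
  J.-integrable setT (EFin \o (fun z => `|wgt m j z.1.1 - wgt m j z.1.2|)).
Proof.
apply: (@bounded_integrable _ _ _ _ _ 1).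
  apply: measurableT_comp => //; apply: measurable_funB.
    exact: measurable_wgt_comp.
  exact: measurable_wgt_comp.
move=> z; rewrite normr_id ler_norml.
have := wgt_ge0 m j z.1.1; have := wgt_ge0 m j z.1.2.
by have := wgt_le1 m j z.1.1; have := wgt_le1 m j z.1.2; lra.
Qed.

Lemma sum_wgt_shift m n e :
  (\int[J]_z (`|z.1.1 - z.1.2|)%:E <= e%:E)%E ->
  \sum_(0 <= j < n) wgt_shift m j <= 4 * m%:R * e.
Proof.
move=> Je; rewrite -Rintegral_sum//.
have I := @integrable_sum _ _ _ J setT measurableT _ (index_iota 0 n) xpredT
    (fun i => EFin \o _) (fun i _ => integrable_dist m i).
rewrite -lee_fin /Rintegral fineK; last first.
  apply: integrable_fin_num => //; apply: eq_integrable I => // x _.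
  by rewrite /= sumEFin.
apply: (@le_trans _ _ (\int[J]_z (4 * m%:R * `|z.1.1 - z.1.2|)%:E)%E).
  apply: ge0_le_integral => //.
  - by move=> z _; rewrite lee_fin sumr_ge0.
  - apply/measurable_EFinP; apply: measurable_sum => i.
    apply: measurableT_comp => //; apply: measurable_funB; exact: measurable_wgt_comp.
  - apply/measurable_EFinP; apply: measurable_funM => //.
    by apply: measurableT_comp => //; exact: measurable_funB.
  - by move=> z _; rewrite lee_fin sum_wgt_dist.
under eq_integral do rewrite EFinM.
rewrite ge0_integralZl//.
- by rewrite [(_ * e)%:E]EFinM lee_wpmul2l// lee_fin mulr_ge0.
- by apply/measurable_EFinP; apply: measurableT_comp => //; exact: measurable_funB.
Qed.

Let piwJ m j : piw D m j = \int[J]_z wgt m j z.1.1.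
Proof.
case: DJ => DJ1 _; rewrite /piw /expect.
apply: (@Rintegral_transfer _ _ _ _ _ J D (fun z => (z.1.1, z.2)) (fun z => wgt m j z.1)) => //.
- exact/measurable_fun_pair.
- exact: measurable_wgt_comp measurable_fst _ _.
- by move=> z; exact: wgt_ge0.
Qed.

Let piwqwJ m j : piw D m j * qw D m j = \int[J]_z (wgt m j z.1.1 * yR z.2).
Proof.
case: DJ => DJ1 _; rewrite piw_qw /expect.
apply: (@Rintegral_transfer _ _ _ _ _ J D (fun z => (z.1.1, z.2))
  (fun z => wgt m j z.1 * yR z.2)) => //.
- exact/measurable_fun_pair.
- exact: measurable_wgt_yR measurable_fst measurable_snd _ _.
- by move=> z; exact: wgt_yR_ge0.
Qed.

Let shiftJ m j :
  `|\int[J]_z wgt m j z.1.1 - \int[J]_z wgt m j z.1.2| <= wgt_shift m j.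
Proof.
rewrite -RintegralB//; [|exact: integrable_wgt|exact: integrable_wgt].
by apply: le_normr_Rintegral => //; apply: integrable_subr; exact: integrable_wgt.
Qed.

Let shiftJy m j :
  `|\int[J]_z (wgt m j z.1.1 * yR z.2) - \int[J]_z (wgt m j z.1.2 * yR z.2)|
  <= wgt_shift m j.
Proof.
have I1 := integrable_wgt_yR J mp my m j.
have I2 := integrable_wgt_yR J mp' my m j.
rewrite -RintegralB//; apply: le_trans (le_normr_Rintegral _ _) _ => //.
  exact: integrable_subr.
apply: le_Rintegral => //.
  by apply: (integrable_norm (f := fun z => _ - _)); exact: integrable_subr.
move=> z _; rewrite -mulrBl normrM (ger0_norm (yR_ge0 _ _)).
by rewrite ler_piMr ?yR_le1.
Qed.

(* [B] and [B'] are the expectations of [w_j(p')] and [w_j(p') y]. *)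
Let calibratedJ m j : exists B B' : R,
  [/\ `|piw D m j - B| <= wgt_shift m j,
      `|piw D m j * qw D m j - B'| <= wgt_shift m j,
      forall t, (forall x : R, wgt m j x * pos x <= t * wgt m j x) -> B' <= t * B &
      forall t, (forall x : R, t * wgt m j x <= wgt m j x * pos x) -> 0 <= t ->
        t * B <= B'].
Proof.
exists (\int[J]_z wgt m j z.1.2), (\int[J]_z (wgt m j z.1.2 * yR z.2)).
rewrite piwqwJ piwJ shiftJ shiftJy.
have [Q [JQ Qcal]] := DJ.2.
have mphi : measurable_fun setT (fun z : (R * R) * bool => (z.1.2, z.2)).
  exact/measurable_fun_pair.
rewrite -(Rintegral_transfer mphi JQ (measurable_wgt_comp measurable_fst m j));
  last by move=> z; exact: wgt_ge0.
rewrite -(Rintegral_transfer mphi JQ (measurable_wgt_yR measurable_fst measurable_snd m j));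
  last by move=> z; exact: wgt_yR_ge0.
have Iw := integrable_wgt Q measurable_fst m j.
have Iwy := integrable_wgt_yR Q measurable_fst measurable_snd m j.
have Itw t : Q.-integrable setT (fun z => (t * wgt m j z.1)%:E).
  by have := integrableZl measurableT t Iw.
have mw : measurable_fun setT (fun z : R * bool => wgt m j z.1 : R).
  exact: measurable_wgt_comp measurable_fst _ _.
have mwp : measurable_fun setT (fun z : R * bool => (wgt m j z.1 * pos z.1)%:E).
  apply/measurable_EFinP; apply: measurable_funM => //.
  by apply: measurable_maxr => //; exact: measurable_fst.
have mtw (t : R) : measurable_fun setT (fun z : R * bool => (t * wgt m j z.1)%:E).
  by apply/measurable_EFinP; exact: measurable_funM.
split=> // t tw => [|t0]; rewrite -RintegralZl//; apply: fine_le.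
- exact: integrable_fin_num.
- exact: integrable_fin_num.
- rewrite (calibrated_integral Qcal (measurable_wgt m j) (wgt_ge0 m j)).
  apply: ge0_le_integral => //.
  + by move=> z _; rewrite lee_fin mulr_ge0 ?wgt_ge0 ?pos_ge0.
  + by move=> z _; rewrite lee_fin tw.
- exact: integrable_fin_num.
- exact: integrable_fin_num.
- rewrite (calibrated_integral Qcal (measurable_wgt m j) (wgt_ge0 m j)).
  apply: ge0_le_integral => //.
  + by move=> z _; rewrite lee_fin mulr_ge0 ?wgt_ge0.
  + by move=> z _; rewrite lee_fin tw.
Qed.

(** With [B' <= t * B] by calibration, replacing [B'] costs one shift and replacing [t * B] costs
    [t] shifts, so [1 + t <= 3] in all. *)
Lemma piw_pos_qw_sub m j (t : R) : 0 <= t <= 2 ->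
  (forall x : R, wgt m j x * pos x <= t * wgt m j x) ->
  piw D m j * pos (qw D m j - t) <= 3 * wgt_shift m j.
Proof.
move=> /andP[t0 t2] tw; have d0 := wgt_shift_ge0 m j.
have [B [B' [h1 h2 /(_ t tw) h3 _]]] := calibratedJ m j.
rewrite /pos /Num.max; case: (ltP (qw D m j - t) 0) => [?|qt]; first by rewrite mulr0; lra.
move: h1 h2 h3; rewrite !ler_norml mulrBr => /andP[h1 h1'] /andP[h2 h2'] h3; nra.
Qed.

Lemma piw_pos_sub_qw m j (t : R) : 0 <= t <= 2 ->
  (forall x : R, t * wgt m j x <= wgt m j x * pos x) ->
  piw D m j * pos (t - qw D m j) <= 3 * wgt_shift m j.
Proof.
move=> /andP[t0 t2] tw; have d0 := wgt_shift_ge0 m j.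
have [B [B' [h1 h2 _ /(_ t tw t0) h3]]] := calibratedJ m j.
rewrite /pos /Num.max; case: (ltP (t - qw D m j) 0) => [?|qt]; first by rewrite mulr0; lra.
move: h1 h2 h3; rewrite !ler_norml mulrBr => /andP[h1 h1'] /andP[h2 h2'] h3; nra.
Qed.

Lemma SCDL_m_le m e : (0 < m)%N -> 0 <= e ->
  (\int[J]_z (`|z.1.1 - z.1.2|)%:E <= e%:E)%E ->
  SCDL_m D m <= 12 * m%:R * e.
Proof.
move=> m0 e0 Je; have m0' : 0 < m%:R :> R by rewrite ltr0n.
have m1 : m%:R^-1 <= 1 :> R by rewrite invf_le1// ler1n.
rewrite /SCDL_m big_seq; apply: (big_ind (fun x => x <= 12 * m%:R * e)) => [|x y ? ?|i].
- by rewrite !mulr_ge0.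
- by rewrite ge_max; apply/andP.
rewrite mem_index_iota => /andP[_ im].
have le_im : i%:R / m%:R <= 1 :> R by rewrite ler_pdivrMr// mul1r ler_nat.
have ge_im : 0 <= i%:R / m%:R :> R by rewrite divr_ge0.
(* The factor 3 is the price per cell and [4 * m * e] bounds the sum of all shifts; each cell occurs
   in exactly one of the two sums. *)
have -> : 12 * m%:R * e = 3 * (4 * m%:R * e) by ring.
apply: le_trans (ler_wpM2l _ (sum_wgt_shift m m.+1 Je)) => //.
rewrite mulr_sumr [leRHS](big_cat_nat _ (n := i.+1))//=.
apply: lerD; rewrite big_seq [leRHS]big_seq; apply: ler_sum => j;
    rewrite mem_index_iota => /andP[ij1 ij2].
  apply: piw_pos_qw_sub => [|x].
    by rewrite -natr1 mulrDl mul1r; have : 0 <= m%:R^-1 :> R; [rewrite invr_ge0|]; lra.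
  (* For [j <= i] the hat lives below [(j + 1) / m], hence below the threshold [(i + 1) / m]. *)
  have [h|h] := leP 1 `|m%:R * x - j%:R|.
    by rewrite wgt_eq0// mul0r mulr0.
  rewrite mulrC ler_wpM2r ?wgt_ge0// /pos ge_max divr_ge0// andbT.
  rewrite ler_pdivlMr// mulrC; move: h; rewrite ltr_norml => /andP[_ h].
  have : j.+1%:R <= i.+1%:R :> R by rewrite ler_nat.
  by rewrite -natr1; lra.
apply: piw_pos_sub_qw => [|x]; first by lra.
(* For [j > i] the hat lives above [(j - 1) / m], hence above the threshold [i / m]. *)
have [h|h] := leP 1 `|m%:R * x - j%:R|.
  by rewrite wgt_eq0// mul0r mulr0.
rewrite mulrC ler_wpM2l ?wgt_ge0// /pos le_max; apply/orP; left.
rewrite ler_pdivrMr// mulrC; move: h; rewrite ltr_norml => /andP[h _].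
have : i.+1%:R <= j%:R :> R by rewrite ler_nat.
by rewrite -natr1; lra.
Qed.

End Transport.

(** Normalising a measure of mass 1 leaves its values unchanged and supplies the probability
    structure. *)
Lemma measure1_probability d (T : measurableType d) (R : realType)
    (nu : {measure set T -> \bar R}) : nu setT = 1%E ->
  exists P : probability T R, forall A, P A = nu A.
Proof.
move=> nu1; exists (mnormalize nu (point : probability T R)) => A.
change (mnormalize nu point A = nu A); rewrite /mnormalize nu1.
by rewrite onee_eq0/= invr1 mule1.
Qed.

(** * The coupling that rounds to cells and predicts the cell mean *)

Section Rounding.
Context (R : realType) (D : probability (R * bool)%type R) (m : nat).
Context (D01 : supported01 D).

Let w j (z : R * bool) : R := wgt m j z.1.

Let mw j : measurable_fun setT (w j).
Proof. exact: measurable_wgt_comp measurable_fst _ _. Qed.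

Let w0 j z : 0 <= w j z. Proof. exact: wgt_ge0. Qed.

Let phi j (z : R * bool) : (R * R) * bool := ((z.1, qw D m j), z.2).

Let mphi j : measurable_fun setT (phi j).
Proof.
apply/measurable_fun_pair; last exact: measurable_snd.
apply/measurable_fun_pair => //; exact: measurable_fst.
Qed.

(** The share of cell [j] in the coupling: [D] reweighted by the hat, with [p'] set to the cell
    mean. The coupling is the sum of these over [j]. *)
Let mu (j : nat) : {measure set ((R * R) * bool) -> \bar R}.
Proof.
unshelve refine (pushforward (density_measure D (mw j) (w0 j)) (phi j)).
exact: mphi.
Defined.

Let muE j A : mu j A = (\int[D]_(z in phi j @^-1` A) (w j z)%:E)%E.
Proof. by []. Qed.

(** The hats sum to 1 only on [[0, 1]], which is enough because [D] lives there almost surely. *)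
Lemma sum_wgt_integral A : measurable A ->
  (\sum_(j < m.+1) \int[D]_(z in A) (wgt m j z.1)%:E)%E = D A.
Proof.
move=> mA; have mwA j : measurable_fun A (fun z => (w j z)%:E).
  by apply/measurable_EFinP; exact: measurable_funTS.
rewrite -ge0_integral_sum//; [|by move=> j; exact: mwA|by move=> j z _; rewrite lee_fin w0].
rewrite -[D A]mul1e -(integral_cst D mA 1).
apply: ae_eq_integral => //.
- by apply: emeasurable_sum => j; exact: mwA.
- apply: filterS (supported01_ae D01) => z z01 _.
  by rewrite sumEFin -(big_mkord xpredT (fun j => wgt m j z.1)) sum_wgt.
Qed.

Lemma piwE j : (\int[D]_z (wgt m j z.1)%:E)%E = (piw D m j)%:E.
Proof.
rewrite fineK//; apply: integrable_fin_num => //.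
exact: integrable_wgt measurable_fst _ _.
Qed.

Lemma piw_qwE j : (\int[D]_z (wgt m j z.1 * yR z.2)%:E)%E = (piw D m j * qw D m j)%:E.
Proof.
rewrite piw_qw fineK//; apply: integrable_fin_num => //.
exact: integrable_wgt_yR measurable_fst measurable_snd _ _.
Qed.

Lemma sum_piw : \sum_(j < m.+1) piw D m j = 1.
Proof.
apply/eqP; rewrite -eqe -sumEFin -(probability_setT D) -sum_wgt_integral//.
by apply/eqP; apply: eq_bigr => j _; rewrite piwE.
Qed.

(** Calibration holds cell by cell, since [y] and the constant [q_j] have the same [w_j]-weighted
    expectation. The integral formula is kept in the conclusion to compute the cost later. *)
Lemma rounding_coupling : exists2 J, coupling D J &
  forall f : (R * R) * bool -> \bar R, measurable_fun setT f ->
    (forall z, 0 <= f z)%E ->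
    (\int[J]_z f z = \sum_(j < m.+1)
      \int[D]_z (f ((z.1, qw D m j), z.2) * (wgt m j z.1)%:E))%E.
Proof.
have muT : msum mu m.+1 setT = 1%E.
  rewrite -(probability_setT D) -(sum_wgt_integral measurableT) /msum.
  by apply: eq_bigr => j _; rewrite muE preimage_setT.
have [J JE] := measure1_probability muT.
have intJ (f : (R * R) * bool -> \bar R) : measurable_fun setT f ->
    (forall z, 0 <= f z)%E ->
    (\int[J]_z f z = \sum_(j < m.+1)
      \int[D]_z (f ((z.1, qw D m j), z.2) * (wgt m j z.1)%:E))%E.
  move=> mf f0; rewrite (eq_measure_integral (msum mu m.+1)); last first.
    by move=> A _ _; exact: JE.
  rewrite ge0_integral_measure_sum//; apply: eq_bigr => j _.
  rewrite (ge0_integral_pushforward (mphi j))// preimage_setT.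
  by rewrite ge0_integral_density//=; exact: measurableT_comp mf (mphi j).
exists J => //; split=> [A mA|].
  rewrite JE /msum/= -[RHS]sum_wgt_integral//; apply: eq_bigr => j _.
  by rewrite muE; congr integral; apply/seteqP; split => -[].
have mpsi : measurable_fun setT (fun z : (R * R) * bool => (z.1.2, z.2)).
  apply/measurable_fun_pair; last exact: measurable_snd.
  exact: measurableT_comp measurable_snd measurable_fst.
have QT : pushforward J (fun z : (R * R) * bool => (z.1.2, z.2)) setT = 1%E.
  by rewrite /pushforward preimage_setT probability_setT.
have [Q QE] := measure1_probability QT.
exists Q; split=> [A _|]; first by rewrite QE.
have intQ (f : R * bool -> \bar R) : measurable_fun setT f ->
    (forall z, 0 <= f z)%E ->
    (\int[Q]_z f z = \sum_(j < m.+1)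
      \int[D]_z (f (qw D m j, z.2) * (wgt m j z.1)%:E))%E.
  move=> mf f0.
  rewrite (eq_measure_integral (pushforward J (fun z => (z.1.2, z.2)))); last first.
    by move=> A _ _; exact: QE.
  rewrite (ge0_integral_pushforward mpsi)// preimage_setT intJ//=.
  exact: measurableT_comp mf mpsi.
have Q01 : supported01 Q.
  apply: (etrans (QE _)); apply: (etrans (JE _)).
  rewrite -(probability_setT D) -(sum_wgt_integral measurableT) /msum.
  apply: eq_bigr => j _.
  rewrite muE; congr integral; apply/seteqP; split=> // z _ /=.
  exact: qw01.
split=> // B mB; have mBT : measurable (B `*` [set: bool]) by exact: measurableX.
have mp : measurable_fun setT (fun z : R * bool => (pos z.1)%:E).
  apply/measurable_EFinP; apply: measurable_maxr => //; exact: measurable_fst.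
have my : measurable_fun setT (fun z : R * bool => (yR z.2)%:E : \bar R).
  by apply/measurable_EFinP; exact: measurableT_comp (@measurable_yR R) measurable_snd.
(* [intQ] asks for integrands that are nonnegative everywhere, so [p'] is replaced by its positive
   part, equal to it almost surely. *)
transitivity (\int[Q]_(z in B `*` setT) (pos z.1)%:E)%E; last first.
  apply: ae_eq_integral => //.
  - exact: measurable_funTS.
  - by apply/measurable_EFinP/measurable_funTS; exact: measurable_fst.
  - apply: filterS (supported01_ae Q01) => z /andP[z0 _] _.
    by rewrite /pos max_l.
have restrict_ge0 (f : R * bool -> \bar R) : (forall z, 0 <= f z)%E ->
    forall z, (0 <= (f \_ (B `*` setT)) z)%E.
  by move=> f0 z; rewrite patchE; case: ifP.
have restrict_mf (f : R * bool -> \bar R) : measurable_fun setT f ->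
    measurable_fun setT (f \_ (B `*` setT)).
  move=> mf; apply: (proj1 (measurable_restrictT f mBT)).
  exact: measurable_funTS mf.
rewrite integral_mkcond [RHS]integral_mkcond.
rewrite [LHS]intQ; first last.
- by apply: restrict_ge0 => z; rewrite lee_fin yR_ge0.
- exact: restrict_mf my.
rewrite [RHS]intQ; first last.
- by apply: restrict_ge0 => z; rewrite lee_fin pos_ge0.
- exact: restrict_mf mp.
apply: eq_bigr => j _.
(* A cell whose mean is outside [B] adds 0 to both sides; any other adds [piw * qw] to both. *)
have [qB|qB] := pselect (B (qw D m j)); last first.
  by rewrite !integral0_eq// => z _; rewrite patchE memNset ?mul0e//= => -[].
transitivity (piw D m j * qw D m j)%:E.
  rewrite -piw_qwE; apply: eq_integral => z _.
  by rewrite patchE mem_set//= -EFinM mulrC.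
under eq_integral => z _.
  rewrite patchE mem_set//= /pos max_l; last by have /andP[] := qw01 D m j.
  over.
rewrite ge0_integralZl//.
- by rewrite piwE -EFinM mulrC.
- by apply/measurable_EFinP; exact: (mw j).
- by move=> z _; rewrite lee_fin wgt_ge0.
- by rewrite lee_fin; have /andP[] := qw01 D m j.
Qed.

End Rounding.

(** * Lower bound: the cost of rounding against [SCDL_m] *)

Section LowerBound.
Context (R : realType) (D : probability (R * bool)%type R) (D01 : supported01 D).

(** Triangle inequality through the grid point [j / m]: the first leg is at most [1 / m] on the
    support of the hat, the second is constant on the cell. *)
Lemma rounding_cost m : (0 < m)%N -> exists2 J, coupling D J &
  (\int[J]_z (`|z.1.1 - z.1.2|)%:E <=
    (m%:R^-1 + \sum_(j < m.+1) piw D m j * `|qw D m j - j%:R / m%:R|)%:E)%E.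
Proof.
move=> m0; have [J DJ JE] := rounding_coupling m D01; exists J => //.
have mdist (c : R) : measurable_fun setT (fun z : R * bool => `|z.1 - c|).
  by apply: measurableT_comp => //; exact: measurable_funB.
have mw j : measurable_fun setT (fun z : R * bool => wgt m j z.1 : R).
  exact: measurable_wgt_comp measurable_fst _ _.
rewrite JE; last 2 first.
- apply/measurable_EFinP; apply: measurableT_comp => //; apply: measurable_funB.
    exact: measurableT_comp measurable_fst measurable_fst.
  exact: measurableT_comp measurable_snd measurable_fst.
- by move=> z; rewrite lee_fin.
rewrite [X in (X + _)%:E](_ : _ = \sum_(j < m.+1) m%:R^-1 * piw D m j); last first.
  by rewrite -mulr_sumr (sum_piw m D01) mulr1.
rewrite -big_split/= -sumEFin.
apply: lee_sum => j _.
apply: (@le_trans _ _ (\int[D]_z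
    ((m%:R^-1 + `|qw D m j - j%:R / m%:R|) * wgt m j z.1)%:E)%E).
  apply: ge0_le_integral => //.
  - by move=> z _; rewrite -EFinM lee_fin mulr_ge0 ?wgt_ge0.
  - under eq_fun do rewrite -EFinM.
    by apply/measurable_EFinP; exact: measurable_funM.
  - by apply/measurable_EFinP; exact: measurable_funM.
  - move=> z _; rewrite -EFinM lee_fin.
    have := ler_distD (j%:R / m%:R) z.1 (qw D m j).
    rewrite (distrC (j%:R / m%:R)) => tri.
    apply: le_trans (ler_wpM2r (wgt_ge0 m j z.1) tri) _.
    rewrite !mulrDl lerD2r [leLHS]mulrC; exact: wgt_near.
under eq_integral do rewrite EFinM.
rewrite ge0_integralZl//.
- by rewrite piwE -EFinM lee_fin mulrDl lerD2l mulrC.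
- by apply/measurable_EFinP; exact: mw.
- by move=> z _; rewrite lee_fin wgt_ge0.
Qed.

Lemma SCDL_m_ge0 m : 0 <= SCDL_m D m.
Proof. by rewrite /SCDL_m; apply: bigmax_ge_id. Qed.

Lemma sum_sqr_le_SCDL_m m : (0 < m)%N ->
  \sum_(j < m.+1) piw D m j * (qw D m j - j%:R / m%:R) ^+ 2 <=
  4 * SCDL_m D m + 2 / m%:R.
Proof.
move=> m0; have m0' : 0 < m%:R :> R by rewrite ltr0n.
set h := m%:R^-1; have h0 : 0 <= h by rewrite invr_ge0 ltW.
have h1 : h <= 1 by rewrite invf_le1// ler1n.
(* Merging both sums of [SCDL_m] into one over all cells allows the sums over cells and thresholds
   to be exchanged. *)
pose c j i := if (j <= i)%N then pos (qw D m j - i.+1%:R * h)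
              else pos (i%:R * h - qw D m j).
pose L i := \sum_(0 <= j < m.+1) piw D m j * c j i.
have LE i : (i < m.+1)%N -> L i <= SCDL_m D m.
  move=> im; apply: (Order.TotalTheory.bigmax_sup_seq _ i) => //.
    by rewrite mem_index_iota.
  rewrite le_eqVlt; apply/orP; left; apply/eqP.
  rewrite /L (big_cat_nat _ (n := i.+1))//=; congr (_ + _);
    apply: eq_big_nat => j /andP[j1 j2]; rewrite /c.
    by rewrite -ltnS j2.
  by rewrite leqNgt j1.
have sumL : \sum_(0 <= i < m.+1) L i <= m.+1%:R * SCDL_m D m.
  apply: (@le_trans _ _ (\sum_(0 <= i < m.+1) SCDL_m D m)).
    by apply: ler_sum_nat => i /andP[_ im]; exact: LE.
  by rewrite sumr_const_nat subn0 mulr_natl.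
have : \sum_(j < m.+1) piw D m j * ((qw D m j - j%:R * h) ^+ 2 - 2 * h) <=
    2 * h * \sum_(0 <= i < m.+1) L i.
  rewrite /L exchange_big_nat/= big_mkord mulr_sumr; apply: ler_sum => j _.
  rewrite -mulr_sumr mulrCA ler_wpM2l ?piw_ge0//.
  by apply: sum_decision_ge => //; [rewrite -ltnS|exact: qw01].
under eq_bigr do rewrite mulrBr.
rewrite sumrB -mulr_suml (sum_piw m D01) mul1r.
have : 2 * h * \sum_(0 <= i < m.+1) L i <= 2 * h * (m.+1%:R * SCDL_m D m).
  by apply: ler_wpM2l => //; rewrite mulr_ge0.
(* There are [m + 1] thresholds with step [h = 1 / m]; [h <= 1] turns the factor into 4. *)
have -> : 2 * h * (m.+1%:R * SCDL_m D m) = 2 * (1 + h) * SCDL_m D m.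
  by rewrite -natr1 /h; field; rewrite gt_eqF.
have := SCDL_m_ge0 m; nra.
Qed.

(** The masses sum to 1, so the difference of the two sides is a variance. *)
Lemma sqr_sum_piw_le m (a : nat -> R) :
  (\sum_(j < m.+1) piw D m j * a j) ^+ 2 <= \sum_(j < m.+1) piw D m j * a j ^+ 2.
Proof.
set A := \sum_(j < m.+1) _.
have : 0 <= \sum_(j < m.+1) piw D m j * (a j - A) ^+ 2.
  by apply: sumr_ge0 => j _; rewrite mulr_ge0 ?piw_ge0 ?sqr_ge0.
rewrite (eq_bigr (fun j : 'I_m.+1 => piw D m j * a j ^+ 2 -
  2 * A * (piw D m j * a j) + A ^+ 2 * piw D m j)); last by move=> j _; ring.
rewrite big_split/= sumrB -!mulr_sumr -/A (sum_piw m D01); lra.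
Qed.

Lemma coupling_cost_ge0 (J : probability ((R * R) * bool)%type R) :
  (0 <= \int[J]_z (`|z.1.1 - z.1.2|)%:E)%E.
Proof. by apply: integral_ge0 => z _; rewrite lee_fin. Qed.

Lemma DistCal_inf_ge0 :
  (0 <= ereal_inf [set (\int[J]_z (`|z.1.1 - z.1.2|)%:E)%E | J in coupling D])%E.
Proof. by apply: le_ereal_inf_tmp => _ [J _ <-]; exact: coupling_cost_ge0. Qed.

(** Rounding with [m = 1] has finite cost, so [fine] in [DistCal] discards nothing. *)
Lemma DistCal_fin : ereal_inf
  [set (\int[J]_z (`|z.1.1 - z.1.2|)%:E)%E | J in coupling D] = (DistCal D)%:E.
Proof.
rewrite /DistCal fineK// ge0_fin_numE ?DistCal_inf_ge0//.
have [J DJ Je] := @rounding_cost 1 isT.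
by apply: le_lt_trans (le_lt_trans Je (ltry _)); apply: ereal_inf_lbound; exists J.
Qed.

Lemma DistCal_ge0 : 0 <= DistCal D.
Proof. by rewrite fine_ge0// DistCal_inf_ge0. Qed.

Lemma DistCal_le m : (0 < m)%N -> DistCal D <=
  m%:R^-1 + \sum_(j < m.+1) piw D m j * `|qw D m j - j%:R / m%:R|.
Proof.
move=> /rounding_cost[J DJ Je]; rewrite -lee_fin -DistCal_fin.
by apply: le_trans Je; apply: ereal_inf_lbound; exists J.
Qed.

Lemma DistCal_lt e : DistCal D < e -> exists2 J, coupling D J &
  (\int[J]_z (`|z.1.1 - z.1.2|)%:E <= e%:E)%E.
Proof.
rewrite -lte_fin -DistCal_fin => /ereal_inf_lt[_ [J DJ <-] Je].
by exists J => //; exact: ltW.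
Qed.

Lemma DistCal_sqr_le m : (0 < m)%N ->
  DistCal D ^+ 2 <= 14 * Num.max (SCDL_m D m) m%:R^-1.
Proof.
move=> m0; have m0' : 0 < m%:R :> R by rewrite ltr0n.
have := DistCal_le m0; have := sum_sqr_le_SCDL_m m0.
have := sqr_sum_piw_le m (fun j => `|qw D m j - j%:R / m%:R|).
under [X in _ <= X -> _]eq_bigr do rewrite real_normK ?num_real//.
have : 0 <= \sum_(j < m.+1) piw D m j * `|qw D m j - j%:R / m%:R|.
  by apply: sumr_ge0 => j _; rewrite mulr_ge0 ?piw_ge0.
have h1 : m%:R^-1 <= 1 :> R by rewrite invf_le1// ler1n.
have h0 : 0 <= m%:R^-1 :> R by rewrite invr_ge0.
have : SCDL_m D m <= Num.max (SCDL_m D m) m%:R^-1 by rewrite le_max lexx.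
have : m%:R^-1 <= Num.max (SCDL_m D m) m%:R^-1 by rewrite le_max lexx orbT.
have := DistCal_ge0.
move: (\sum_(j < _) _ * _ ^+ 2) (\sum_(j < _) _) (SCDL_m D m) => S A s.
move: (Num.max _ _) (DistCal D) => M d d0 hM sM A0 AS Ss dA.
have : d ^+ 2 <= (m%:R^-1 + A) ^+ 2 by rewrite lerXn2r// nnegrE addr_ge0.
move: (m%:R^-1) h0 h1 hM Ss dA => h h0 h1 hM Ss dA.
(* [(h + A)^2 <= 2 h^2 + 2 A^2 <= 2 h + 2 (4 s + 2 h) = 8 s + 6 h], which is at most [14 * M]. *)
have := sqr_ge0 (h - A); nra.
Qed.

End LowerBound.

(** * Choice of the dyadic scale and the final constants *)

Section Bounds.
Context (R : realType) (D : probability (R * bool)%type R) (D01 : supported01 D).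

Lemma DistCal_sqr_le_SCDL : 14^-1 * DistCal D ^+ 2 <= SCDL D.
Proof.
apply: lb_le_inf; first by exists (Num.max (SCDL_m D (2 ^ 1)) (2 ^ 1)%:R^-1), 1%N.
move=> _ [k [_ ->]].
have := @DistCal_sqr_le R D D01 (2 ^ k); rewrite expn_gt0 => /(_ isT).
by move: (Num.max _ _) (DistCal D ^+ 2) => *; lra.
Qed.

Lemma SCDL_le k : (1 <= k)%N -> SCDL D <= Num.max (SCDL_m D (2 ^ k)) (2 ^ k)%:R^-1.
Proof.
move=> k1; apply: ge_inf; last by exists k.
by exists 0 => _ [i [_ ->]]; rewrite le_max SCDL_m_ge0.
Qed.

(** The inequality on [e] is strict because the infimum in [DistCal] is not known to be attained. *)
Lemma SCDL_le_coupling k e : (1 <= k)%N -> DistCal D < e ->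
  SCDL D <= Num.max (12 * (2 ^ k)%:R * e) (2 ^ k)%:R^-1.
Proof.
move=> k1 de; have e0 : 0 <= e by apply: le_trans (ltW de); exact: DistCal_ge0.
have [J DJ Je] := DistCal_lt D01 de.
apply: le_trans (SCDL_le k1) _; rewrite ge_max !le_max lexx orbT andbT.
by rewrite (SCDL_m_le DJ _ e0 Je)// expn_gt0.
Qed.

(** Rounding with [m = 1] costs at most 1 for each leg. This leaves room for some [e <= 4] strictly
    above [DistCal D]. *)
Lemma DistCal_le2 : DistCal D <= 2.
Proof.
apply: le_trans (DistCal_le D01 (isT : (0 < 1)%N)) _.
have -> : 2 = 1^-1 + 1 :> R by rewrite invr1.
rewrite lerD2l -[leRHS](sum_piw 1 D01); apply: ler_sum => j _.
rewrite ler_piMr ?piw_ge0// divr1 ler_norml.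
have /andP[? ?] := qw01 D 1 j.
have : (j : nat)%:R <= 1 :> R by rewrite lern1 -ltnS.
have : 0 <= (j : nat)%:R :> R by [].
by move: (j : nat)%:R => *; lra.
Qed.

Lemma dyadic_near (x : R) : 0 < x <= 1 -> exists k : nat,
  [/\ (1 <= k)%N, (2 ^ k)%:R^-1 <= x & x * (2 ^ k)%:R <= 2].
Proof.
move=> /andP[x0 x1].
have xV (k : nat) : (x^-1 <= (2 ^ k)%:R) = (1 <= x * (2 ^ k)%:R).
  by rewrite -[x^-1]mulr1 ler_pdivrMl.
have ex : exists k : nat, (1 <= k)%N && (1 <= x * (2 ^ k)%:R).
  exists (Num.bound x^-1).+1; rewrite /= -xV.
  have := archi_boundP (_ : 0 <= x^-1); rewrite invr_ge0 (ltW x0) => /(_ isT) /ltW h.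
  apply: le_trans h _; rewrite ler_nat ltnW// ltnW//.
  exact: ltn_expl.
have [k /andP[k1 kx] kmin] := ex_minnP ex.
have k0 : 0 < (2 ^ k)%:R :> R by rewrite ltr0n expn_gt0.
exists k; split => //; first by rewrite -[_^-1]mul1r ler_pdivrMr.
(* [k = 1] uses [x <= 1]; for larger [k], a product above 2 would make [k - 1] admissible, against
   minimality. *)
case: k k1 kx kmin k0 => [//|[|k]] _ kx kmin k0.
  by rewrite expn1; lra.
rewrite leNgt; apply/negP => h; suff /kmin : (1 <= k.+1)%N && (1 <= x * (2 ^ k.+1)%:R).
  by rewrite ltnn.
by move: h; rewrite /= (expnS _ k.+1) natrM; lra.
Qed.

Lemma SCDL_le_sqrt e : DistCal D < e -> e <= 4 -> SCDL D <= 48 * Num.sqrt e.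
Proof.
move=> de e4; have e0 : 0 < e by apply: le_lt_trans de; exact: DistCal_ge0.
set r := Num.sqrt e; have r0 : 0 < r by rewrite sqrtr_gt0.
have re : e = r ^+ 2 by rewrite sqr_sqrtr// ltW.
have [r1|r1] := leP r 1.
  have [k [k1 kr rk]] := @dyadic_near r (introT andP (conj r0 r1)).
  apply: le_trans (SCDL_le_coupling k1 de) _.
  rewrite ge_max; apply/andP; split; last by apply: le_trans kr _; lra.
  by rewrite re; nra.
(* For [r > 1] the coarsest scale [m = 2] is used: [24 * r^2 <= 48 * r] since [e <= 4] gives
   [r <= 2]. This case fixes the constant 48. *)
apply: le_trans (SCDL_le_coupling (leqnn 1) de) _.
rewrite expn1 ge_max; apply/andP; split; last by lra.
by rewrite re in e4 *; nra.
Qed.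

Lemma SCDL_le_sqrt_DistCal : SCDL D <= 48 * Num.sqrt (DistCal D).
Proof.
rewrite leNgt; apply/negP => lt; have d0 := DistCal_ge0 D.
pose t := SCDL D / 48.
have dt : Num.sqrt (DistCal D) < t by rewrite /t; lra.
have t0 : 0 < t by apply: le_lt_trans dt; exact: sqrtr_ge0.
have dt2 : DistCal D < t ^+ 2.
  by rewrite -[ltLHS](sqr_sqrtr d0) ltrXn2r// ?nnegrE ?sqrtr_ge0 ?ltW.
have d2 := DistCal_le2.
(* A value strictly between [DistCal D] and [t ^+ 2], capped at 4; this also covers
   [DistCal D = 0]. *)
pose e := Num.min 4 ((DistCal D + t ^+ 2) / 2).
have de : DistCal D < e by rewrite lt_min; apply/andP; split; lra.
have et : e < t ^+ 2 by rewrite gt_min; apply/orP; right; lra.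
have := SCDL_le_sqrt de; rewrite ge_min lexx => /(_ isT).
have : Num.sqrt e < t.
  by rewrite -[ltRHS]gtr0_norm// -sqrtr_sqr ltr_sqrt ?exprn_gt0.
by rewrite /t; lra.
Qed.

End Bounds.

Theorem theorem6p1 :
  exists c C : Rdefinitions.R, 0 < c /\ 0 < C /\
    forall D, @supported01 Rdefinitions.R D ->
      c * DistCal D ^+ 2 <= SCDL D /\ SCDL D <= C * Num.sqrt (DistCal D).
Proof.
exists 14^-1, 48; split; first by rewrite invr_gt0.
split=> // D D01.
by split; [exact: DistCal_sqr_le_SCDL|exact: SCDL_le_sqrt_DistCal].
Qed.
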